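(* Fix $N\in\mathbb{N}$, $N\ge 1$. The subset of morphisms of $\mathsf{Mat}^N$ consisting of the rank-$N$ charge-conserving-with-glue (CCwg) matrices forms a strict monoidal subcategory of $\mathsf{Mat}^N$ (with the same objects). That is, identity matrices are CCwg, the product $LM$ of composable CCwg matrices $L,M$ is CCwg, and the Kronecker product $L\otimes M$ of CCwg matrices $L,M$ is CCwg.
   Context: Fix a ground field $k$ (one may take $k=\mathbb{C}$). $\underline{N}=\{1,\dots,N\}$ and $\underline{N}^n$ is the set of words $w=w_1\cdots w_n$ of length $n$. The strict monoidal category $\mathsf{Mat}^N$ has object monoid $(\mathbb{N}_0,+)$; $\mathsf{Mat}^N(n,m)$ is the set of matrices over $k$ with rows labelled by $\underline{N}^n$ and columns by $\underline{N}^m$, the entry of $M$ in row $w$ and column $v$ being written $\langle w|M|v\rangle$ or $M_{w,v}$. Composition is matrix multiplication, and the monoidal product on morphisms is the Kronecker product: for $L\in\mathsf{Mat}^N(n,n')$, $M\in\mathsf{Mat}^N(m,m')$, $\langle ww'|L\otimes M|vv'\rangle=\langle w|L|v\rangle\langle w'|M|v'\rangle$ for $w\in\underline{N}^n,w'\in\underline{N}^m,v\in\underline{N}^{n'},v'\in\underline{N}^{m'}$ (juxtaposition is concatenation). $\Lambda^N_n=\{\lambda\in\mathbb{N}_0^N:\sum_i\lambda_i=n\}$, and $\mathsf{f}:\underline{N}^n\to\Lambda^N_n$ is $\mathsf{f}(w)_i=|\{j: w_j=i\}|$. The total order $<$ on $\Lambda^N_n$ is defined as follows: order $\underline{N}^n$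 by reverse lexicographic (revlex) order, in which earlier letters change quickest (i.e. $w$ precedes $v$ if $w_j<v_j$ at the largest position $j$ where they differ); then $\lambda<\mu$ if the first word $w$ with $\mathsf{f}(w)=\lambda$ precedes the first word $v$ with $\mathsf{f}(v)=\mu$. Elements of $\Lambda^N_n$ and $\Lambda^N_{n'}$ with $n\neq n'$ are incomparable. A matrix $M$ in $\mathsf{Mat}^N$ is rank-$N$ charge-conserving-with-glue (CCwg) if $\langle w|M|v\rangle\neq0$ implies $\mathsf{f}(w)\le\mathsf{f}(v)$. (So a CCwg matrix in $\mathsf{Mat}^N(n,m)$ with $n\ne m$ is zero.) *)

(* Defs.v *)
From HB Require Import structures.
From mathcomp Require Import all_boot all_order all_algebra.

Set Implicit Arguments.
Unset Strict Implicit.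
Unset Printing Implicit Defensive.

Import GRing.Theory.
Local Open Scope ring_scope.

(* Letters 1..N are represented by 0..N-1, with the same order. *)
Notation word N n := (n.-tuple 'I_N).

Notation charge N := {ffun 'I_N -> nat}.

Definition Lambda (N n : nat) : pred (charge N) :=
  [pred l : charge N | (\sum_(i < N) l i)%N == n].

Definition content (N n : nat) (w : word N n) : charge N :=
  [ffun i => #|[set j | tnth w j == i]|].

(* Reverse lexicographic order: the last position of disagreement decides. *)
Definition revlex (N n : nat) (w v : word N n) : Prop :=
  exists j : 'I_n,
    (tnth w j < tnth v j)%N /\
    (forall i : 'I_n, (j < i)%N -> tnth w i = tnth v i).

Definition first_word (N n : nat) (l : charge N) (w : word N n) : Prop :=
  content w = l /\
  (forall w' : word N n, content w' = l -> w' = w \/ revlex w w').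

(* The length n is shared by both sides, so that charges of different total
   are incomparable. *)
Definition charge_lt (N : nat) (l m : charge N) : Prop :=
  exists n : nat,
    [/\ l \in Lambda n, m \in Lambda n &
        exists w v : word N n, [/\ first_word l w, first_word m v & revlex w v]].

Definition charge_le (N : nat) (l m : charge N) : Prop :=
  l = m \/ charge_lt l m.

(* Rows and columns are labelled by words through enum_rank; the composite of
   L : Mat k N n m and M : Mat k N m p is L *m M. *)
Notation Mat k N n m := 'M[k]_(#|{: word N n}|, #|{: word N m}|).

Definition entry (k : fieldType) (N n m : nat) (M : Mat k N n m)
  (w : word N n) (v : word N m) : k := M (enum_rank w) (enum_rank v).

Definition lword (N n m : nat) (w : word N (n + m)) : word N n :=
  [tuple tnth w (lshift m i) | i < n].

Definition rword (N n m : nat) (w : word N (n + m)) : word N m :=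
  [tuple tnth w (rshift n i) | i < m].

(* Kronecker product; the defining formula on concatenated words is kronE. *)
Definition kron (k : fieldType) (N n n' m m' : nat)
  (L : Mat k N n n') (M : Mat k N m m') : Mat k N (n + m) (n' + m') :=
  \matrix_(i, j)
    (entry L (lword (enum_val i)) (lword (enum_val j)) *
     entry M (rword (enum_val i)) (rword (enum_val j))).

Definition CCwg (k : fieldType) (N n m : nat) (M : Mat k N n m) : Prop :=
  forall (w : word N n) (v : word N m),
    entry M w v <> 0 -> charge_le (content w) (content v).

(* A class of morphisms that contains every object's identity and is closed
   under composition and monoidal product; the category and strict monoidal
   laws are then inherited. *)
Definition wide_monoidal_subcategory (k : fieldType) (N : nat)
  (P : forall n m : nat, Mat k N n m -> Prop) : Prop :=
  [/\ (forall n : nat, P n n 1%:M),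
      (forall (n m p : nat) (L : Mat k N n m) (M : Mat k N m p),
         P n m L -> P m p M -> P n p (L *m M)) &
      (forall (n n' m m' : nat) (L : Mat k N n n') (M : Mat k N m m'),
         P n n' L -> P m m' M -> P (n + m)%N (n' + m')%N (kron L M))].

Lemma entry1 (k : fieldType) (N n : nat) (w v : word N n) :
  entry (1%:M : Mat k N n n) w v = (w == v)%:R.
Proof. by rewrite /entry mxE (inj_eq enum_rank_inj). Qed.

Lemma entryM (k : fieldType) (N n m p : nat)
  (L : Mat k N n m) (M : Mat k N m p) (w : word N n) (v : word N p) :
  entry (L *m M) w v = \sum_(u : word N m) entry L w u * entry M u v.
Proof.
rewrite /entry mxE (reindex (@enum_rank _)) //=.
by apply: onW_bij; apply: enum_rank_bij.
Qed.

Lemma lword_cat (N n m : nat) (w : word N n) (w' : word N m) :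
  lword [tuple of w ++ w'] = w.
Proof. by apply: eq_from_tnth => i; rewrite tnth_mktuple tnth_lshift. Qed.

Lemma rword_cat (N n m : nat) (w : word N n) (w' : word N m) :
  rword [tuple of w ++ w'] = w'.
Proof. by apply: eq_from_tnth => i; rewrite tnth_mktuple tnth_rshift. Qed.

Lemma kronE (k : fieldType) (N n n' m m' : nat)
  (L : Mat k N n n') (M : Mat k N m m')
  (w : word N n) (w' : word N m) (v : word N n') (v' : word N m') :
  entry (kron L M) [tuple of w ++ w'] [tuple of v ++ v'] =
  entry L w v * entry M w' v'.
Proof. by rewrite {1}/entry mxE !enum_rankK !lword_cat !rword_cat. Qed.

(* Main.v *)
Require Import Defs.
From mathcomp Require Import all_boot all_order all_algebra.

(** The abstract order on charges is turned into an explicit one.  The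
    revlex-first word of a charge is its weakly decreasing word, because small
    letters should sit as far right as possible.  At the last position where two
    decreasing words disagree, the smaller word has a letter [a] that
    occurs more often in it, whereas letters below [a] occur equally often in
    both.  Hence the order on charges of a given total is the lexicographic one
    in which more of a smaller letter comes first: [lex_le] below, with
    [charge_le_contentP] giving the equivalence.

    This order is transitive and compatible with addition of charges.
    The diagonal entries of an identity matrix relate equal charges; a nonzero
    entry of a product [L *m M] passes through an intermediate word, so
    transitivity applies; the charge of a concatenated word is the sum of the
    charges of its parts, so a nonzero entry of a Kronecker product is handled
    by additivity ([lex_le_add]). *)

(** Phrased as an implication, so that equality of charges and a strict
    inequality at the first difference need not be distinguished. *)
Definition lex_le {N : nat} (l m : charge N) : Prop :=
  forall i : 'I_N, (forall j : 'I_N, j < i -> l j = m j) -> m i <= l i.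

Lemma ord_strong_ind (N : nat) (P : 'I_N -> Prop) :
  (forall i : 'I_N, (forall j : 'I_N, j < i -> P j) -> P i) -> forall i, P i.
Proof.
move=> IH i; have [b] := ubnP (val i).
elim: b i => // b IHb i ib; apply: IH => j ji.
exact/IHb/(leq_trans ji).
Qed.

Lemma lex_le_anti {N : nat} (l m : charge N) :
  lex_le l m -> lex_le m l -> l = m.
Proof.
move=> lm ml; apply/ffunP; elim/ord_strong_ind => i IH.
by apply/eqP; rewrite eqn_leq lm // ml // => j /IH.
Qed.

Lemma lex_le_trans {N : nat} (m l p : charge N) :
  lex_le l m -> lex_le m p -> lex_le l p.
Proof.
move=> lm mp i lp.
(* The outer charges agree below i, so the middle one is squeezed there. *)
have lmE : forall j : 'I_N, j < i -> l j = m j.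
  elim/ord_strong_ind => j IH ji.
  have lmj : forall h : 'I_N, h < j -> l h = m h.
    by move=> h hj; apply: IH hj (ltn_trans hj ji).
  apply/eqP; rewrite eqn_leq lm // andbT lp //; apply: mp => h hj.
  by rewrite -lmj // lp // (ltn_trans hj ji).
apply: leq_trans (lm i lmE); apply: mp => j ji.
by rewrite -lmE // lp.
Qed.

(** If the two sums agree below a letter, then so do the summands, since
    neither difference can compensate the other. *)
Lemma lex_le_add {N : nat} (l m l' m' : charge N) :
  lex_le l m -> lex_le l' m' ->
  lex_le [ffun i => l i + l' i] [ffun i => m i + m' i].
Proof.
move=> lm lm' i sumE; rewrite !ffunE.
have E : forall j : 'I_N, j < i -> l j = m j /\ l' j = m' j.
  elim/ord_strong_ind => j IH ji.
  have lmj : m j <= l j.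
    by apply: lm => h hj; case: (IH h hj (ltn_trans hj ji)).
  have lmj' : m' j <= l' j.
    by apply: lm' => h hj; case: (IH h hj (ltn_trans hj ji)).
  have := sumE j ji; rewrite !ffunE => /eqP.
  by rewrite eq_sym (leqif_add (leqif_eq lmj) (leqif_eq lmj'))
    => /andP[/eqP-> /eqP->].
by apply: leq_add; [apply: lm | apply: lm'] => j /E[].
Qed.

Lemma contentE {N n : nat} (w : word N n) (i : 'I_N) :
  content w i = \sum_(j < n) (tnth w j == i).
Proof.
by rewrite ffunE -sum1_card big_mkcond; apply: eq_bigr => j _; rewrite inE; case: eqP.
Qed.

Lemma content_total {N n : nat} (w : word N n) : \sum_(i < N) content w i = n.
Proof.
under eq_bigr do rewrite contentE.
rewrite exchange_big /= -[RHS]card_ord -sum1_card; apply: eq_bigr => j _.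
by rewrite (bigD1 (tnth w j)) //= eqxx big1 // => i; rewrite eq_sym => /negPf->.
Qed.

Lemma content_Lambda {N n : nat} (w : word N n) : content w \in Lambda n.
Proof. by apply/eqP/content_total. Qed.

(** The reason why additivity of the order on charges matters for Kronecker
    products. *)
Lemma content_split {N n m : nat} (w : word N (n + m)) :
  content w = [ffun i => content (lword w) i + content (rword w) i].
Proof.
apply/ffunP => i; rewrite [RHS]ffunE !contentE big_split_ord /=.
by congr (_ + _); apply: eq_bigr => j _; rewrite tnth_mktuple.
Qed.

Lemma perm_content {N n : nat} (w v : word N n) :
  perm_eq w v -> content w = content v.
Proof.
move=> wv; apply/ffunP => i.
rewrite !contentE -!(big_tuple _ _ _ predT (fun x => nat_of_bool (x == i))).
exact: perm_big.
Qed.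

Lemma revlex_total {N n : nat} (w v : word N n) :
  [\/ w = v, revlex w v | revlex v w].
Proof.
case: (pickP (fun j => tnth w j != tnth v j)) => [j0 dj0 | wv]; last first.
  by constructor 1; apply: eq_from_tnth => j; apply/eqP/negbFE/wv.
case: (@arg_maxnP _ j0 (fun j => tnth w j != tnth v j) val dj0) => j dj jmax.
have agree : forall i : 'I_n, j < i -> tnth w i = tnth v i.
  move=> i ji; apply/eqP; apply: contraLR ji => /jmax.
  by rewrite -leqNgt.
case: (ltngtP (tnth w j) (tnth v j)) => [lt_wv|lt_vw|eq_wv].
- by constructor 2; exists j.
- by constructor 3; exists j; split=> // i /agree.
- by rewrite -(inj_eq val_inj) /= eq_wv eqxx in dj.
Qed.

Definition decreasing {N n : nat} (w : word N n) : Prop :=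
  forall i j : 'I_n, i <= j -> tnth w j <= tnth w i.

(** With [j] the last disagreement and [a] the letter of [w] there, the letters
    up to [a] occur in the decreasing word [v] only after [j], where [w] has them
    too; and [w] has one more [a], at [j] itself. *)
Lemma revlex_decreasing {N n : nat} (w v : word N n) :
  decreasing v -> revlex w v ->
  lex_le (content w) (content v) /\ content w <> content v.
Proof.
move=> dec [j [wvj agree]]; set a := tnth w j.
have le_occ : forall (b : 'I_N) (i : 'I_n), b <= a ->
    (tnth v i == b) <= (tnth w i == b).
  move=> b i ba; case: (ltnP j i) => [/agree-> // | ij].
  case: eqP => // vib; have := leq_trans wvj (dec _ _ ij).
  by rewrite vib ltnNge ba.
have le_cont : forall b : 'I_N, b <= a -> content v b <= content w b.
  by move=> b ba; rewrite !contentE; apply: leq_sum => i _; apply: le_occ.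
have lt_cont : content v a < content w a.
  rewrite !contentE (bigD1 j) //= [X in _ < X](bigD1 j) //= eqxx.
  have /negPf-> : tnth v j != a.
    by rewrite -(inj_eq val_inj) gtn_eqF.
  by rewrite add0n add1n ltnS; apply: leq_sum => i _; apply: le_occ.
split=> [i eqi | E]; last by rewrite E ltnn in lt_cont.
case: (leqP i a) => [/le_cont // | /eqi E].
by rewrite E ltnn in lt_cont.
Qed.

Lemma decreasing_rearrangement {N n : nat} (w : word N n) :
  exists2 s : word N n, content s = content w & decreasing s.
Proof.
pose r : rel 'I_N := fun x y => y <= x.
have rtr : transitive r by move=> y x z /= yx zy; apply: leq_trans zy yx.
have rtot : total r by move=> x y; apply: leq_total.
exists [tuple of sort r w]; first by apply: perm_content; rewrite /= perm_sort.
move=> i j ij; have x0 := tnth w i.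
rewrite !(tnth_nth x0) /=.
apply: (sorted_leq_nth rtr _ x0 (sort_sorted rtot w)) => //; first exact: leqnn.
- by rewrite inE size_sort size_tuple.
- by rewrite inE size_sort size_tuple.
Qed.

Lemma decreasing_first {N n : nat} (w : word N n) :
  decreasing w -> first_word (content w) w.
Proof.
move=> dec; split=> // w' E; case: (revlex_total w w') => [->||]; [by left|by right|].
by move=> /(revlex_decreasing _ _ dec)[_ /(_ E)].
Qed.

(** By [revlex_decreasing], nothing precedes a decreasing word among the words
    of its charge, so the first word equals its own decreasing rearrangement. *)
Lemma first_decreasing {N n : nat} (l : charge N) (w : word N n) :
  first_word l w -> decreasing w.
Proof.
move=> [wl wmin]; have [s sE sdec] := decreasing_rearrangement w.
case: (wmin s) => [|<- // | /(revlex_decreasing _ _ sdec)[_]]; first by rewrite sE.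
by rewrite sE.
Qed.

Lemma charge_leW {N : nat} (l m : charge N) :
  charge_le l m -> \sum_(i < N) l i = \sum_(i < N) m i /\ lex_le l m.
Proof.
case=> [-> | [n [/eqP ln /eqP mn [w [v [fw fv wv]]]]]]; first by split.
split; first by rewrite ln mn.
case: (fw) (fv) => [<- _] [<- _].
by have [] := revlex_decreasing _ _ (first_decreasing _ _ fv) wv.
Qed.

(** The first words of both charges exist, being decreasing rearrangements, and
    revlex compares them; the wrong comparison would force equal charges by
    antisymmetry.  The equality [n = m] is what makes charges of different totals
    incomparable. *)
Lemma charge_le_contentP {N n m : nat} (w : word N n) (v : word N m) :
  charge_le (content w) (content v) <->
  n = m /\ lex_le (content w) (content v).
Proof.
split=> [/charge_leW[] | [nm]]; first by rewrite !content_total.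
subst m => wv; have [w0 w0E w0dec] := decreasing_rearrangement w.
have [v0 v0E v0dec] := decreasing_rearrangement v.
case: (revlex_total w0 v0) => [E | lt_wv | lt_vw].
- by left; rewrite -w0E -v0E E.
- right; exists n; split; [exact: content_Lambda | exact: content_Lambda |].
  exists w0, v0; split=> //; first by rewrite -w0E; apply: decreasing_first.
  by rewrite -v0E; apply: decreasing_first.
- left; apply: lex_le_anti => //; rewrite -w0E -v0E.
  by have [] := revlex_decreasing _ _ w0dec lt_vw.
Qed.

Lemma entry_kron (k : fieldType) {N n n' m m' : nat}
    (L : Mat k N n n') (M : Mat k N m m')
    (w : word N (n + m)) (v : word N (n' + m')) :
  entry (kron L M) w v =
  (entry L (lword w) (lword v) * entry M (rword w) (rword v))%R.
Proof. by rewrite {1}/entry mxE !enum_rankK. Qed.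

Lemma CCwg1 (k : fieldType) (N n : nat) : CCwg (1%:M%R : Mat k N n n).
Proof. by move=> w v; rewrite entry1; case: eqP => [-> _ | //]; left. Qed.

Lemma CCwgM (k : fieldType) (N n m p : nat)
    (L : Mat k N n m) (M : Mat k N m p) :
  CCwg L -> CCwg M -> CCwg (L *m M)%R.
Proof.
move=> cL cM w v; rewrite entryM => nz.
case: (pickP (fun u => (entry L w u * entry M u v)%R != 0%R)) => [u | z0]; last first.
  by case: nz; apply: big1 => u _; apply/eqP/negbFE/z0.
rewrite GRing.mulf_eq0 negb_or => /andP[/eqP/cL wu /eqP/cM uv].
move/charge_le_contentP: wu => [nm wu]; move/charge_le_contentP: uv => [mp uv].
by apply/charge_le_contentP; split; [rewrite nm | apply: lex_le_trans wu uv].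
Qed.

Lemma CCwg_kron (k : fieldType) (N n n' m m' : nat)
    (L : Mat k N n n') (M : Mat k N m m') :
  CCwg L -> CCwg M -> CCwg (kron L M).
Proof.
move=> cL cM w v; rewrite entry_kron => /eqP.
rewrite GRing.mulf_eq0 negb_or => /andP[/eqP/cL wv /eqP/cM wv'].
move/charge_le_contentP: wv => [nn wv]; move/charge_le_contentP: wv' => [mm wv'].
apply/charge_le_contentP; split; first by rewrite nn mm.
by rewrite !content_split; apply: lex_le_add.
Qed.

Theorem mainTheorem1 (k : fieldType) (N : nat) (hN : (1 <= N)%N) :
  wide_monoidal_subcategory (fun (n m : nat) (M : Mat k N n m) => CCwg M).
Proof.
split; [exact: CCwg1 | exact: CCwgM | exact: CCwg_kron].
Qed.
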